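(* Let $(M,A,f)$ be a Hom-associative algebra in $\mathcal{LM}$ over a field $K$ of characteristic $0$ and let $N=(N_0,N_1)$ be a Nijenhuis operator on it. Then a $1$-parameter infinitesimal deformation of $(M,A,f)$ is generated by $(\omega,\mu,\nu,\theta)$, where $$\theta(m)=(f N_1-N_0 f)(m),$$ $$\omega(x,y)=N_0(x)y+xN_0(y)-N_0(xy),$$ $$\mu(x,m)=N_0(x)\cdot m+x\cdot N_1(m)-N_1(x\cdot m),$$ $$\nu(m,x)=m\cdot N_0(x)+N_1(m)\cdot x-N_1(m\cdot x),$$ for $x,y\in A$, $m\in M$. Furthermore, this deformation is trivial.
   Context: A Hom-associative algebra $(A,\alpha)$ is a vector space $A$ with a bilinear multiplication and a linear map $\alpha:A\to A$ with $\alpha(x)(yz)=(xy)\alpha(z)$; Hom-associative algebras are always assumed multiplicative: $\alpha(xy)=\alpha(x)\alpha(y)$. A bimodule of $(A,\alpha)$ is a vector space $M$ with a linear map $\alpha_M:M\to M$ and bilinear left and right actions $x\cdot m$, $m\cdot x\in M$ such that for all $x,y\in A$, $m\in M$: $\alpha_M(x\cdot m)=\alpha(x)\cdot\alpha_M(m)$, $\alpha_M(m\cdot x)=\alpha_M(m)\cdot\alpha(x)$, $\alpha(x)\cdot(y\cdot m)=(xy)\cdot\alpha_M(m)$, $\alpha_M(m)\cdot(xy)=(m\cdot x)\cdot\alpha(y)$, $\alpha(x)\cdot(m\cdot y)=(x\cdot m)\cdot\alpha(y)$. A Hom-associative algebra $(M,A,f)$ in $\mathcal{LM}$ consists of a Hom-associative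 algebra $(A,\alpha)$, a bimodule $(M,\alpha_M)$ of it, and a linear map $f:M\to A$ with $\alpha\circ f=f\circ\alpha_M$, $f(x\cdot m)=xf(m)$, $f(m\cdot x)=f(m)x$. A morphism $(M,A,f)\to(M',A',f')$ is a pair of linear maps $\phi_0:A\to A'$, $\phi_1:M\to M'$ commuting with the Hom-maps such that $\phi_0(xy)=\phi_0(x)\phi_0(y)$, $\phi_1(x\cdot m)=\phi_0(x)\cdot\phi_1(m)$, $\phi_1(m\cdot x)=\phi_1(m)\cdot\phi_0(x)$, $f'\circ\phi_1=\phi_0\circ f$. Nijenhuis operator: a pair of linear maps $N_0:A\to A$, $N_1:M\to M$ with $N_0\alpha=\alpha N_0$, $N_1\alpha_M=\alpha_MN_1$ (i.e. a $1$-cochain with coefficients in the adjoint representation) such that for all $x,y\in A$, $m\in M$: (i) $\mathrm{Im}(f\circ N_1-N_0\circ f)\subseteq\ker N_0$; (ii) $N_0(x\cdot_Ny)=N_0(x)N_0(y)$; (iii) $N_1(x\cdot_Nm)=N_0(x)\cdot N_1(m)$; (iv) $N_1(m\cdot_Nx)=N_1(m)\cdot N_0(x)$, where $x\cdot_Ny=N_0(x)y+xN_0(y)-N_0(xy)$, $x\cdot_Nm=N_0(x)\cdot m+x\cdot N_1(m)-N_1(x\cdot m)$, $m\cdot_Nx=N_1(m)\cdot x+m\cdot N_0(x)-N_1(m\cdot x)$. Linear maps $\theta:M\to A$, $\omega:A\otimes A\to A$, $\mu:A\otimes M\to M$, $\nu:M\otimes A\to M$ generate a $1$-parameter infinitesimal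 deformation if for all $\lambda\in K$ the operations $f_\lambda=f+\lambda\theta$, $x\cdot_\lambda y=xy+\lambda\omega(x,y)$, $x\cdot_\lambda m=x\cdot m+\lambda\mu(x,m)$, $m\cdot_\lambda x=m\cdot x+\lambda\nu(m,x)$, together with the same Hom-maps, make $(M_\lambda,A_\lambda,f_\lambda)$ (with underlying spaces $M,A$) a Hom-associative algebra in $\mathcal{LM}$. The deformation is trivial if there exist linear maps $N_0:A\to A$, $N_1:M\to M$ such that, for all $\lambda$, $(T_0,T_1)=(\mathrm{id}+\lambda N_0,\mathrm{id}+\lambda N_1)$ is a morphism from $(M_\lambda,A_\lambda,f_\lambda)$ to $(M,A,f)$. *)

(* Defs.v *)
From mathcomp Require Import all_boot all_algebra.

Set Implicit Arguments.
Unset Strict Implicit.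
Unset Printing Implicit Defensive.

Import GRing.Theory.
Local Open Scope ring_scope.

(* Vector spaces are arbitrary (possibly infinite-dimensional) lmodTypes over a
   field.  Operations are plain functions, with (bi)linearity part of the axioms,
   so that the operations on the fixed spaces M and A can be deformed. *)

Definition bilinear_map (K : fieldType) (U V W : lmodType K) (b : U -> V -> W) :
  Prop := bilinear_for *:%R *:%R b.

Record is_hom_assoc (K : fieldType) (A : lmodType K)
    (mul : A -> A -> A) (alpha : A -> A) : Prop := IsHomAssoc {
  ha_mul_bilinear : bilinear_map mul;
  ha_alpha_linear : linear alpha;
  ha_assoc : forall x y z, mul (alpha x) (mul y z) = mul (mul x y) (alpha z);
  ha_multiplicative : forall x y, alpha (mul x y) = mul (alpha x) (alpha y)
}.

Record is_hom_bimodule (K : fieldType) (A M : lmodType K)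
    (mul : A -> A -> A) (alpha : A -> A)
    (lact : A -> M -> M) (ract : M -> A -> M) (alphaM : M -> M) : Prop :=
  IsHomBimodule {
  hb_lact_bilinear : bilinear_map lact;
  hb_ract_bilinear : bilinear_map ract;
  hb_alphaM_linear : linear alphaM;
  hb_alphaM_lact : forall x m, alphaM (lact x m) = lact (alpha x) (alphaM m);
  hb_alphaM_ract : forall m x, alphaM (ract m x) = ract (alphaM m) (alpha x);
  hb_lact_lact : forall x y m,
    lact (alpha x) (lact y m) = lact (mul x y) (alphaM m);
  hb_ract_ract : forall m x y,
    ract (alphaM m) (mul x y) = ract (ract m x) (alpha y);
  hb_lact_ract : forall x m y,
    lact (alpha x) (ract m y) = ract (lact x m) (alpha y)
}.

Record LM_data (K : fieldType) (A M : lmodType K) := LMData {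
  lm_mul : A -> A -> A;
  lm_alpha : A -> A;
  lm_lact : A -> M -> M;
  lm_ract : M -> A -> M;
  lm_alphaM : M -> M;
  lm_f : M -> A
}.

Record is_hom_assoc_LM (K : fieldType) (A M : lmodType K) (S : LM_data A M) :
    Prop := IsHomAssocLM {
  lm_algebra : is_hom_assoc (lm_mul S) (lm_alpha S);
  lm_bimodule :
    is_hom_bimodule (lm_mul S) (lm_alpha S)
      (lm_lact S) (lm_ract S) (lm_alphaM S);
  lm_f_linear : linear (lm_f S);
  lm_f_alpha : forall m, lm_alpha S (lm_f S m) = lm_f S (lm_alphaM S m);
  lm_f_lact : forall x m, lm_f S (lm_lact S x m) = lm_mul S x (lm_f S m);
  lm_f_ract : forall m x, lm_f S (lm_ract S m x) = lm_mul S (lm_f S m) x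
}.

Record is_LM_morphism (K : fieldType) (A M A' M' : lmodType K)
    (S : LM_data A M) (S' : LM_data A' M')
    (phi0 : A -> A') (phi1 : M -> M') : Prop := IsLMMorphism {
  mor_linear0 : linear phi0;
  mor_linear1 : linear phi1;
  mor_alpha0 : forall x, phi0 (lm_alpha S x) = lm_alpha S' (phi0 x);
  mor_alpha1 : forall m, phi1 (lm_alphaM S m) = lm_alphaM S' (phi1 m);
  mor_mul : forall x y, phi0 (lm_mul S x y) = lm_mul S' (phi0 x) (phi0 y);
  mor_lact : forall x m, phi1 (lm_lact S x m) = lm_lact S' (phi0 x) (phi1 m);
  mor_ract : forall m x, phi1 (lm_ract S m x) = lm_ract S' (phi1 m) (phi0 x);
  mor_f : forall m, lm_f S' (phi1 m) = phi0 (lm_f S m)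
}.

Definition nij_mul (K : fieldType) (A M : lmodType K) (S : LM_data A M)
    (N0 : A -> A) (x y : A) : A :=
  lm_mul S (N0 x) y + lm_mul S x (N0 y) - N0 (lm_mul S x y).

Definition nij_lact (K : fieldType) (A M : lmodType K) (S : LM_data A M)
    (N0 : A -> A) (N1 : M -> M) (x : A) (m : M) : M :=
  lm_lact S (N0 x) m + lm_lact S x (N1 m) - N1 (lm_lact S x m).

Definition nij_ract (K : fieldType) (A M : lmodType K) (S : LM_data A M)
    (N0 : A -> A) (N1 : M -> M) (m : M) (x : A) : M :=
  lm_ract S (N1 m) x + lm_ract S m (N0 x) - N1 (lm_ract S m x).

Record is_nijenhuis (K : fieldType) (A M : lmodType K) (S : LM_data A M)
    (N0 : A -> A) (N1 : M -> M) : Prop := IsNijenhuis {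
  nij_linear0 : linear N0;
  nij_linear1 : linear N1;
  nij_alpha0 : forall x, N0 (lm_alpha S x) = lm_alpha S (N0 x);
  nij_alpha1 : forall m, N1 (lm_alphaM S m) = lm_alphaM S (N1 m);
  (* Im (f N1 - N0 f) is contained in ker N0 *)
  nij_im_ker : forall m, N0 (lm_f S (N1 m) - N0 (lm_f S m)) = 0;
  nij_mulP : forall x y, N0 (nij_mul S N0 x y) = lm_mul S (N0 x) (N0 y);
  nij_lactP : forall x m, N1 (nij_lact S N0 N1 x m) = lm_lact S (N0 x) (N1 m);
  nij_ractP : forall m x, N1 (nij_ract S N0 N1 m x) = lm_ract S (N1 m) (N0 x)
}.

Definition deform (K : fieldType) (A M : lmodType K) (S : LM_data A M)
    (theta : M -> A) (omega : A -> A -> A) (mu : A -> M -> M)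
    (nu : M -> A -> M) (lambda : K) : LM_data A M :=
  {| lm_mul := fun x y => lm_mul S x y + lambda *: omega x y;
     lm_alpha := lm_alpha S;
     lm_lact := fun x m => lm_lact S x m + lambda *: mu x m;
     lm_ract := fun m x => lm_ract S m x + lambda *: nu m x;
     lm_alphaM := lm_alphaM S;
     lm_f := fun m => lm_f S m + lambda *: theta m |}.

(* Linear maps out of the tensor products are given by bilinear maps. *)
Record generates_deformation (K : fieldType) (A M : lmodType K)
    (S : LM_data A M) (theta : M -> A) (omega : A -> A -> A)
    (mu : A -> M -> M) (nu : M -> A -> M) : Prop := GeneratesDeformation {
  def_theta_linear : linear theta;
  def_omega_bilinear : bilinear_map omega;
  def_mu_bilinear : bilinear_map mu;
  def_nu_bilinear : bilinear_map nu;
  def_LM : forall lambda : K,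
    is_hom_assoc_LM (deform S theta omega mu nu lambda)
}.

Definition trivial_deformation (K : fieldType) (A M : lmodType K)
    (S : LM_data A M) (theta : M -> A) (omega : A -> A -> A)
    (mu : A -> M -> M) (nu : M -> A -> M) : Prop :=
  exists (N0 : A -> A) (N1 : M -> M),
    [/\ linear N0, linear N1 &
      forall lambda : K,
        is_LM_morphism (deform S theta omega mu nu lambda) S
          (fun x => x + lambda *: N0 x) (fun m => m + lambda *: N1 m)].

(* Main.v *)
Require Import Defs.
From mathcomp Require Import all_boot all_algebra.

(** Think of [l] as a formal parameter.  Then [T = id + l N] is invertible, and
    transporting the structure of [(M, A, f)] along [T] gives an isomorphic
    structure, with operations [T^-1 (p (T u) (T v))] and [T^-1 f T].  These are
    in general power series in [l]; the Nijenhuis conditions say exactly that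
    they stop at degree one:
    [T (p u v + l p' u v) = p (T u) (T v)] holds because [N (p' u v)] equals
    [p (N u) (N v)], and [T (f m + l theta m) = f (T m)] holds because
    [N0 (theta m) = 0].  So the deformed operations are the transported ones,
    and they satisfy all the axioms; the two equations also say that [T]
    is a morphism to [(M, A, f)], that is, that the deformation is trivial.

    For a value of [l] in [K] the map [T] need not be injective, so the axioms
    are not read off from the transport but checked coefficient by coefficient
    in [l].  The coefficient of degree zero is the axiom for [(M, A, f)], that
    of degree one follows from the formula for [p'] because [N] commutes with
    the Hom-maps, and that of degree two uses the Nijenhuis conditions.

    Multiplication and actions are treated together as [nijenhuis_pairing]s.
    All four associativity axioms, of [A] and of the bimodule, are instances of
    [deformed_associative], and the two axioms relating [f] to the actions are
    instances of [deformed_equivariant], one of them after exchanging the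
    arguments ([nijenhuis_pairing_flip]); triviality comes from
    [deformed_pairing_morphism]. *)

Set Implicit Arguments.
Unset Strict Implicit.
Unset Printing Implicit Defensive.

Import GRing.Theory.
Local Open Scope ring_scope.

(** * Computing with unbundled linear and bilinear maps *)

(** The conclusion is a tuple of equations so that it can be used as a single
    rewriting multirule. *)
Lemma linear_expand (K : fieldType) (U V : lmodType K) (f : U -> V) :
  linear f ->
  (({morph f : x y / x + y})%R * ({morph f : x / - x})%R
   * (forall a, {morph f : x / (a *: x)%R}))%type.
Proof.
move=> lin_f.
have fZ := GRing.scalable_linear lin_f.
split; [split|] => [x y|x|//]; last by rewrite -!scaleN1r fZ.
by rewrite -[x]scale1r lin_f !scale1r.
Qed.

Lemma bilinear_expandl (K : fieldType) (U V W : lmodType K) (b : U -> V -> W) :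
  bilinear_map b ->
  ((forall x y v, b (x + y) v = b x v + b y v)%R
   * (forall x v, b (- x) v = - b x v)%R
   * (forall a x v, b (a *: x) v = a *: b x v)%R)%type.
Proof.
move=> [lin_b _]; split; [split|] => [x y v|x v|a x v].
- exact: (linear_expand (lin_b v)).1.1.
- exact: (linear_expand (lin_b v)).1.2.
- exact: (linear_expand (lin_b v)).2.
Qed.

Lemma bilinear_expandr (K : fieldType) (U V W : lmodType K) (b : U -> V -> W) :
  bilinear_map b ->
  ((forall u, {morph b u : x y / x + y})%R
   * (forall u, {morph b u : x / - x})%R
   * (forall u a, {morph b u : x / a *: x})%R)%type.
Proof.
move=> [_ lin_b]; split; [split|] => [u|u|u a].
- exact: (linear_expand (lin_b u)).1.1.
- exact: (linear_expand (lin_b u)).1.2.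
- exact: (linear_expand (lin_b u)).2.
Qed.

Lemma linear_comb (K : fieldType) (U V : lmodType K) (f g : U -> V) (l : K) :
  linear f -> linear g -> linear (fun x => f x + l *: g x).
Proof.
move=> lin_f lin_g a x y; rewrite lin_f lin_g !scalerDr !scalerA.
by rewrite (mulrC l) addrACA.
Qed.

Lemma bilinear_comb (K : fieldType) (U V W : lmodType K)
    (b c : U -> V -> W) (l : K) :
  bilinear_map b -> bilinear_map c ->
  bilinear_map (fun x y => b x y + l *: c x y).
Proof.
by move=> [bl br] [cl cr]; split=> u; exact: linear_comb.
Qed.

(** * Nijenhuis pairings *)

(** The multiplication of [A] and its two actions on [M] satisfy the same
    identities up to the types of the arguments, so the computations are done
    once, for a pairing [p] of two arbitrary spaces with values in a third.
    Here [p'] is the derivative at [0] of the transport of [p] along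
    [id + l N]. *)
Record nijenhuis_pairing (K : fieldType) (U V P : lmodType K)
    (p p' : U -> V -> P) (NU : U -> U) (NV : V -> V) (NP : P -> P) : Prop :=
  NijenhuisPairing {
  np_bilinear : bilinear_map p;
  np_linearl : linear NU;
  np_linearr : linear NV;
  np_linear : linear NP;
  np_twist : forall u v, p' u v = p (NU u) v + p u (NV v) - NP (p u v);
  np_mul : forall u v, NP (p' u v) = p (NU u) (NV v)
}.

Lemma nijenhuis_pairing_flip (K : fieldType) (U V P : lmodType K)
    (p p' : U -> V -> P) (NU : U -> U) (NV : V -> V) (NP : P -> P) :
  nijenhuis_pairing p p' NU NV NP ->
  nijenhuis_pairing (fun v u => p u v) (fun v u => p' u v) NV NU NP.
Proof.
case=> [[pl pr] linU linV linP p'E NPp']; split=> // v u.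
by rewrite p'E (addrC (p (NU u) v)).
Qed.

Lemma twist_bilinear (K : fieldType) (U V P : lmodType K)
    (p p' : U -> V -> P) (NU : U -> U) (NV : V -> V) (NP : P -> P) :
  nijenhuis_pairing p p' NU NV NP -> bilinear_map p'.
Proof.
(* Up to exchanging the arguments, only linearity in the second is needed. *)
have lin_r (U' V' : lmodType K) (q q' : U' -> V' -> P) NU' NV' NP' :
    nijenhuis_pairing q q' NU' NV' NP' -> forall u, linear (q' u).
  case=> [bil_q _ linV linP q'E _] u a x y.
  rewrite !q'E linV !(bilinear_expandr bil_q) linP.
  rewrite !(scalerDr, scalerN) opprD.
  by rewrite (addrACA (a *: _)) [LHS]addrACA.
by move=> npp; split; [exact: (lin_r _ _ _ _ _ _ _ (nijenhuis_pairing_flip npp))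
                      | exact: (lin_r _ _ _ _ _ _ _ npp)].
Qed.

(** The terms linear in [l] agree by the formula for [p'], the quadratic ones by
    Nijenhuis's identity [np_mul]. *)
Lemma deformed_pairing_morphism (K : fieldType) (U V P : lmodType K)
    (p p' : U -> V -> P) (NU : U -> U) (NV : V -> V) (NP : P -> P) (l : K) :
  nijenhuis_pairing p p' NU NV NP ->
  forall u v, (p u v + l *: p' u v) + l *: NP (p u v + l *: p' u v)
              = p (u + l *: NU u) (v + l *: NV v).
Proof.
case=> [bil_p _ _ linP p'E NPp'] u v.
rewrite !(linear_expand linP) NPp' !(bilinear_expandl bil_p).
rewrite !(bilinear_expandr bil_p) !scalerDr p'E scalerBr scalerDr !addrA subrK.
by rewrite (addrAC (p u v)).
Qed.

Lemma deformed_pairing_multiplicative (K : fieldType) (U V P : lmodType K)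
    (p p' : U -> V -> P) (NU : U -> U) (NV : V -> V) (NP : P -> P)
    (aU : U -> U) (aV : V -> V) (aP : P -> P) (l : K) :
  nijenhuis_pairing p p' NU NV NP -> linear aP ->
  (forall u, NU (aU u) = aU (NU u)) -> (forall v, NV (aV v) = aV (NV v)) ->
  (forall x, NP (aP x) = aP (NP x)) ->
  (forall u v, aP (p u v) = p (aU u) (aV v)) ->
  forall u v, aP (p u v + l *: p' u v)
              = p (aU u) (aV v) + l *: p' (aU u) (aV v).
Proof.
case=> [_ _ _ _ p'E _] linaP NaU NaV NaP apE u v.
rewrite !p'E -[p (aU u) (aV v)]apE NaP NaU NaV.
by rewrite !(linear_expand linaP) !apE.
Qed.

(** * Associativity and equivariance of the deformed operations *)

(** [twist1] and [twist2] are the coefficients of [l] and [l ^+ 2] in either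
    bracketing of a deformed triple product, written in terms of the undeformed
    triple product [t].  They treat the three arguments alike, which is why the
    two bracketings agree. *)
Definition twist1 (K : fieldType) (U V W T : lmodType K)
    (t : U -> V -> W -> T) (NU : U -> U) (NV : V -> V) (NW : W -> W)
    (NT : T -> T) (u : U) (v : V) (w : W) : T :=
  t (NU u) v w + t u (NV v) w + t u v (NW w) - NT (t u v w).

Definition twist2 (K : fieldType) (U V W T : lmodType K)
    (t : U -> V -> W -> T) (NU : U -> U) (NV : V -> V) (NW : W -> W)
    (NT : T -> T) (u : U) (v : V) (w : W) : T :=
  t (NU u) (NV v) w + t (NU u) v (NW w) + t u (NV v) (NW w)
  - NT (t (NU u) v w + t u (NV v) w + t u v (NW w)) + NT (NT (t u v w)).

Lemma twist_right_bracketing (K : fieldType) (U V W Q T : lmodType K)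
    (r r' : V -> W -> Q) (s s' : U -> Q -> T) (aU : U -> U)
    (NU : U -> U) (NV : V -> V) (NW : W -> W) (NQ : Q -> Q) (NT : T -> T) :
  nijenhuis_pairing r r' NV NW NQ -> nijenhuis_pairing s s' NU NQ NT ->
  (forall u, NU (aU u) = aU (NU u)) ->
  let t u v w := s (aU u) (r v w) in
  forall u v w,
    s (aU u) (r' v w) + s' (aU u) (r v w) = twist1 t NU NV NW NT u v w
    /\ s' (aU u) (r' v w) = twist2 t NU NV NW NT u v w.
Proof.
case=> [bil_r _ _ _ r'E NQr'] [bil_s _ _ linT s'E NTs'] NaU t u v w.
have lT := linear_expand linT; have sr := bilinear_expandr bil_s.
split.
  rewrite /twist1 /t s'E r'E !sr NaU !addrA.
  (* the two occurrences of [s (aU u) (NQ (r v w))] cancel *)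
  by rewrite [LHS](ACl (4*1*2*6*3*5)) /= subrK.
(* [np_mul] for [s] at [NQ (r v w)] eliminates the one term in which [NU] and
   [NQ] occur together *)
have sNN : s (NU (aU u)) (NQ (r v w)) =
    NT (s (NU (aU u)) (r v w)) + NT (s (aU u) (NQ (r v w)))
    - NT (NT (s (aU u) (r v w))).
  by rewrite -NTs' s'E !lT.
rewrite s'E NQr' r'E !sr sNN /twist2 /t !lT NaU.
rewrite !(opprD, opprK) !addrA.
by rewrite [LHS](ACl (1*2*6*3*7*8*5*4*9)) /= subrK.
Qed.

(** Exchanging the arguments of both pairings reverses the triple product and
    turns one bracketing into the other. *)
Lemma twist_left_bracketing (K : fieldType) (U V W P T : lmodType K)
    (p p' : U -> V -> P) (q q' : P -> W -> T) (aW : W -> W)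
    (NU : U -> U) (NV : V -> V) (NW : W -> W) (NP : P -> P) (NT : T -> T) :
  nijenhuis_pairing p p' NU NV NP -> nijenhuis_pairing q q' NP NW NT ->
  (forall w, NW (aW w) = aW (NW w)) ->
  let t u v w := q (p u v) (aW w) in
  forall u v w,
    q (p' u v) (aW w) + q' (p u v) (aW w) = twist1 t NU NV NW NT u v w
    /\ q' (p' u v) (aW w) = twist2 t NU NV NW NT u v w.
Proof.
move=> npp npq NaW t u v w.
have [] := twist_right_bracketing (nijenhuis_pairing_flip npp)
  (nijenhuis_pairing_flip npq) NaW w v u.
move=> /= -> ->; rewrite /twist1 /twist2 /t; split.
  by rewrite [X in X - _](ACl (3*2*1)).
by rewrite [X in X - _ + _](ACl (3*2*1)) [X in - NT X](ACl (3*2*1)).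
Qed.

Lemma collect_degrees (K : fieldType) (V : lmodType K) (l : K)
    (x0 x1 y1 x2 : V) :
  x0 + l *: x1 + l *: (y1 + l *: x2) = x0 + l *: (x1 + y1) + l *: (l *: x2).
Proof. by rewrite !scalerDr !addrA. Qed.

(** Four pairings are needed because the intermediate values [p u v] and
    [r v w] lie in spaces of their own, as when an element of [M] is multiplied
    by elements of [A] on both sides. *)
Lemma deformed_associative (K : fieldType) (U V W P Q T : lmodType K)
    (p p' : U -> V -> P) (q q' : P -> W -> T)
    (r r' : V -> W -> Q) (s s' : U -> Q -> T) (aU : U -> U) (aW : W -> W)
    (NU : U -> U) (NV : V -> V) (NW : W -> W) (NP : P -> P) (NQ : Q -> Q)
    (NT : T -> T) (l : K) :
  nijenhuis_pairing p p' NU NV NP -> nijenhuis_pairing q q' NP NW NT ->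
  nijenhuis_pairing r r' NV NW NQ -> nijenhuis_pairing s s' NU NQ NT ->
  (forall u, NU (aU u) = aU (NU u)) -> (forall w, NW (aW w) = aW (NW w)) ->
  (forall u v w, s (aU u) (r v w) = q (p u v) (aW w)) ->
  forall u v w,
    s (aU u) (r v w + l *: r' v w) + l *: s' (aU u) (r v w + l *: r' v w)
    = q (p u v + l *: p' u v) (aW w) + l *: q' (p u v + l *: p' u v) (aW w).
Proof.
move=> npp npq npr nps NaU NaW assoc u v w.
rewrite !(bilinear_expandr (np_bilinear nps)).
rewrite !(bilinear_expandr (twist_bilinear nps)).
rewrite !(bilinear_expandl (np_bilinear npq)).
rewrite !(bilinear_expandl (twist_bilinear npq)) !collect_degrees.
have [-> ->] := twist_right_bracketing npr nps NaU u v w.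
have [-> ->] := twist_left_bracketing npp npq NaW u v w.
by rewrite /twist1 /twist2 !assoc.
Qed.

(** Here [tf] and [tg] measure how far [f] and [g] are from commuting with the
    Nijenhuis operators.  Their values lie in the kernels of these operators,
    which removes the terms of degree two that [np_mul] leaves over. *)
Lemma deformed_equivariant (K : fieldType) (U V P V' P' : lmodType K)
    (p p' : U -> V -> P) (q q' : U -> V' -> P')
    (NU : U -> U) (NV : V -> V) (NP : P -> P) (NV' : V' -> V') (NP' : P' -> P')
    (f tf : V -> V') (g tg : P -> P') (l : K) :
  nijenhuis_pairing p p' NU NV NP -> nijenhuis_pairing q q' NU NV' NP' ->
  linear g -> linear tg ->
  (forall v, tf v = f (NV v) - NV' (f v)) ->
  (forall x, tg x = g (NP x) - NP' (g x)) ->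
  (forall v, NV' (tf v) = 0) -> (forall x, NP' (tg x) = 0) ->
  (forall u v, g (p u v) = q u (f v)) ->
  forall u v,
    g (p u v + l *: p' u v) + l *: tg (p u v + l *: p' u v)
    = q u (f v + l *: tf v) + l *: q' u (f v + l *: tf v).
Proof.
move=> npp npq lin_g lin_tg tfE tgE Ntf Ntg gp u v.
have lg := linear_expand lin_g; have lN := linear_expand (np_linear npq).
have qr := bilinear_expandr (np_bilinear npq).
have deg1 : g (p' u v) + tg (p u v) = q u (tf v) + q' u (f v).
  rewrite (np_twist npp) (np_twist npq) !lg tgE !gp tfE !qr !addrA subrK.
  by rewrite [RHS](ACl (3*1*5*4*2)) /= addrK.
have deg2 : tg (p' u v) = q' u (tf v).
  have q0 : q u (NV' (tf v)) = 0.
    by rewrite Ntf -[0 in LHS](scale0r 0) qr scale0r.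
  (* [Ntg] at [p u v] trades [g \o NP] for [NP' \o g] under [NP'] *)
  have NgN : NP' (g (NP (p u v))) = NP' (NP' (q u (f v))).
    by apply: subr0_eq; rewrite -gp -[RHS](Ntg (p u v)) tgE !lN.
  rewrite tgE (np_mul npp) (np_twist npp) !lg !gp !lN NgN.
  rewrite (np_twist npq) q0 addr0 tfE !qr -(np_mul npq) (np_twist npq) !lN.
  rewrite !(opprD, opprK) !addrA.
  by rewrite [RHS](ACl (1*2*5*4*3*6)) /= subrK.
rewrite !lg !(linear_expand lin_tg) !qr.
rewrite !(bilinear_expandr (twist_bilinear npq)) !collect_degrees.
by rewrite gp deg1 deg2.
Qed.

(** * The deformation generated by a Nijenhuis operator *)

Theorem theorem5p4 (K : fieldType) (char0 : [pchar K] =i pred0)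
    (A M : lmodType K) (S : LM_data A M) (hS : is_hom_assoc_LM S)
    (N0 : A -> A) (N1 : M -> M) (hN : is_nijenhuis S N0 N1)
    (theta : M -> A) (omega : A -> A -> A)
    (mu : A -> M -> M) (nu : M -> A -> M)
    (thetaE : forall m, theta m = lm_f S (N1 m) - N0 (lm_f S m))
    (omegaE : forall x y,
       omega x y = lm_mul S (N0 x) y + lm_mul S x (N0 y) - N0 (lm_mul S x y))
    (muE : forall x m,
       mu x m = lm_lact S (N0 x) m + lm_lact S x (N1 m) - N1 (lm_lact S x m))
    (nuE : forall m x,
       nu m x = lm_ract S m (N0 x) + lm_ract S (N1 m) x - N1 (lm_ract S m x)) :
  generates_deformation S theta omega mu nu /\
  trivial_deformation S theta omega mu nu.
Proof.
case: hS => [[mul_bil alpha_lin mulA alpha_mul]].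
case=> [lact_bil ract_bil alphaM_lin alphaM_l alphaM_r lactA ractA lractA].
move=> f_lin f_alpha f_l f_r.
case: hN => [N0_lin N1_lin N0_alpha N1_alpha Ntheta0 N0_mul N1_l N1_r].
have npA : nijenhuis_pairing (lm_mul S) omega N0 N0 N0.
  by split=> // x y; rewrite omegaE -?N0_mul.
have npL : nijenhuis_pairing (lm_lact S) mu N0 N1 N1.
  by split=> // x m; rewrite muE -?N1_l.
have npR : nijenhuis_pairing (lm_ract S) nu N1 N0 N1.
  by split=> // m x; rewrite nuE (addrC (lm_ract S m _)) -?N1_r.
have Ntheta m : N0 (theta m) = 0 by rewrite thetaE.
have f_exp := linear_expand f_lin; have N0_exp := linear_expand N0_lin.
have theta_lin : linear theta.
  move=> a x y; rewrite !thetaE N1_lin !f_lin N0_lin scalerBr opprD.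
  by rewrite addrACA.
have omega_bil := twist_bilinear npA.
have mu_bil := twist_bilinear npL.
have nu_bil := twist_bilinear npR.
have id_comb (V : lmodType K) (N : V -> V) (l : K) :
    linear N -> linear (fun v => v + l *: N v) by exact: linear_comb.
split.
  split=> // l; split; rewrite /deform /=.
  - split; first exact: bilinear_comb.
    + exact: alpha_lin.
    + exact: (deformed_associative l npA npA npA npA N0_alpha N0_alpha mulA).
    + exact: (deformed_pairing_multiplicative l npA alpha_lin N0_alpha N0_alpha
        N0_alpha alpha_mul).
  - split; [exact: bilinear_comb|exact: bilinear_comb|exact: alphaM_lin|..].
    + exact: (deformed_pairing_multiplicative l npL alphaM_lin N0_alpha N1_alpha
        N1_alpha alphaM_l).
    + exact: (deformed_pairing_multiplicative l npR alphaM_lin N1_alpha N0_alpha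
        N1_alpha alphaM_r).
    + exact: (deformed_associative l npA npL npL npL N0_alpha N1_alpha lactA).
    + exact: (deformed_associative l npR npR npA npR N1_alpha N0_alpha ractA).
    + exact: (deformed_associative l npL npR npR npL N0_alpha N0_alpha lractA).
  - exact: linear_comb.
  - move=> m; rewrite !thetaE !(linear_expand alpha_lin).
    by rewrite N1_alpha -!f_alpha N0_alpha.
  - exact: (deformed_equivariant l npL npA f_lin theta_lin thetaE thetaE
      Ntheta Ntheta f_l).
  - move=> m x.
    exact: (deformed_equivariant l (nijenhuis_pairing_flip npR)
      (nijenhuis_pairing_flip npA) f_lin theta_lin thetaE thetaE
      Ntheta Ntheta (fun x m => f_r m x)).
exists N0, N1; split=> // l; split; rewrite /deform /=.
- exact: id_comb.
- exact: id_comb.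
- by move=> x; rewrite !(linear_expand alpha_lin) N0_alpha.
- by move=> m; rewrite !(linear_expand alphaM_lin) N1_alpha.
- exact: (deformed_pairing_morphism l npA).
- exact: (deformed_pairing_morphism l npL).
- exact: (deformed_pairing_morphism l npR).
- move=> m; rewrite !f_exp !N0_exp Ntheta scaler0 addr0 thetaE scalerBr.
  by rewrite addrA subrK.
Qed.
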